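(* Let $\Psi:[0,1]\to[0,1]$. If $\Psi(0)=0$, then $\mathrm{ProbPer}_\Psi(\mathcal{X})=\mathrm{ProbPer}_\Psi(\emptyset)=0$. If $\Psi$ is concave and non-decreasing, then $\mathrm{ProbPer}_\Psi$ is submodular, meaning that $$\mathrm{ProbPer}_\Psi(A\cup B)+\mathrm{ProbPer}_\Psi(A\cap B)\le\mathrm{ProbPer}_\Psi(A)+\mathrm{ProbPer}_\Psi(B)\qquad\forall A,B\in\mathcal{A}.$$
   Context: Setting: $\mathcal{X}$ is a set, $\mathcal{A}\subset 2^{\mathcal{X}}$ a $\sigma$-algebra, and $\mu$ a probability measure on $(\mathcal{X}\times\{0,1\},\mathcal{A}\otimes 2^{\{0,1\}})$. For $i\in\{0,1\}$ put $\rho_i(B):=\mu(B\times\{i\})$, and $\rho:=\rho_0+\rho_1$. $\{\mathfrak{m}_x\}_{x\in\mathcal{X}}$ is a family such that $\mathfrak{m}_x$ is a probability measure on $(\mathcal{X},\mathcal{A})$ for $\rho$-almost every $x$, and $x\mapsto\mathfrak{m}_x(B)$ is measurable for every $B\in\mathcal{A}$. For $A\in\mathcal{A}$ (with $A^c=\mathcal{X}\setminus A$): $$\mathrm{ProbPer}_\Psi(A):=\int_{A^c}\Psi(\mathfrak{m}_x(A))\,d\rho_0(x)+\int_{A}\Psi(\mathfrak{m}_x(A^c))\,d\rho_1(x).$$ *)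

(* Defs.v *)
From HB Require Import structures.
From mathcomp Require Import all_boot all_order all_algebra.
From mathcomp Require Import all_classical all_reals all_analysis.

Set Implicit Arguments.
Unset Strict Implicit.
Unset Printing Implicit Defensive.

Import Order.TTheory GRing.Theory Num.Theory.
Import numFieldNormedType.Exports.

Local Open Scope classical_set_scope.
Local Open Scope ring_scope.
Local Open Scope convex_scope.

(* The dual of [convex_function]. *)
Definition concave_function (R : numFieldType) (E : lmodType R)
    (E' := convex_lmodType E) (D : set E') (f : E' -> R^o) :=
  forall t : {i01 R},
    {in D &, forall x y : E',
       ((f x : R^o) <| t |> (f y : R^o) <= f (x <| t |> y))%R}.

(* MathComp-Analysis measures are total on [set X]; only the values on the
   sigma-algebra are constrained here. *)
Definition is_probability d (X : measurableType d) (R : realType)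
    (P : set X -> \bar R) : Prop :=
  exists Q : probability X R, forall B, measurable B -> P B = Q B.

Section class_measures.
Local Open Scope ereal_scope.
Context d (X : measurableType d) (R : realType).
Variables (mu : probability (X * bool)%type R) (i : bool).

(* The labels 0 and 1 are encoded as [false] and [true]. *)
Definition rho (B : set X) : \bar R := mu (B `*` [set i]).

Let mX B : measurable B -> measurable (B `*` [set i] : set (X * bool)).
Proof. by move=> mB; exact: measurableX. Qed.

Let rho0 : rho set0 = 0.
Proof. by rewrite /rho set0X measure0. Qed.

Let rho_ge0 B : 0 <= rho B.
Proof. exact: measure_ge0. Qed.

Let rho_sigma_additive : semi_sigma_additive rho.
Proof.
move=> F mF tF mUF; rewrite /rho.
rewrite (_ : (\bigcup_n F n) `*` [set i] = \bigcup_n (F n `*` [set i])); last first.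
  apply/seteqP; split => -[x j] /=; first by move=> [[n _ Fx] ji]; exists n.
  by move=> [n _ [Fx ji]]; split => //; exists n.
apply: measure_semi_sigma_additive.
- by move=> n; exact: mX.
- apply/trivIsetP => m n _ _ mn.
  move/trivIsetP : tF => /(_ m n Logic.I Logic.I mn) Fmn.
  apply/seteqP; split => // -[x j] /= [[Fmx _] [Fnx _]].
  by rewrite -[False]/(set0 x) -Fmn.
- by apply: bigcup_measurable => n _; exact: mX.
Qed.

HB.instance Definition _ := isMeasure.Build _ _ _ rho
  rho0 rho_ge0 rho_sigma_additive.

Let rho_fin : fin_num_fun rho.
Proof. by move=> B mB; exact: fin_num_measure (mX mB). Qed.

HB.instance Definition _ := Measure_isFinite.Build _ _ _ rho rho_fin.

End class_measures.

(* [fine] only matters on the [rho]-null set of points where [m x] is not a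
   probability measure, hence does not affect the integrals. *)
Definition ProbPer d (X : measurableType d) (R : realType)
    (mu : probability (X * bool)%type R) (m : X -> set X -> \bar R)
    (Psi : R -> R) (A : set X) : \bar R :=
  (\int[rho mu false]_(x in ~` A) (Psi (fine (m x A)))%:E +
   \int[rho mu true]_(x in A) (Psi (fine (m x (~` A))))%:E)%E.

(* Main.v *)
Require Import Defs.
From HB Require Import structures.
From mathcomp Require Import all_boot all_order all_algebra.
From mathcomp Require Import all_classical all_reals all_analysis.
From mathcomp Require Import measurable_realfun.
From mathcomp Require Import ring lra.

Import Order.TTheory GRing.Theory Num.Theory.
Import numFieldNormedType.Exports.

Local Open Scope classical_set_scope.
Local Open Scope ring_scope.

(** For each label the perimeter is the integral of [Psi (m x C)] over the
    complement of [C], with [C] replaced by its complement for the label 1. Since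
    complementation exchanges unions and intersections, it suffices that each
    half is submodular, and this holds pointwise: outside [A `|` B] because
    [m x (A `|` B) + m x (A `&` B) = m x A + m x B] and [Psi] is concave, and
    elsewhere because [Psi] is non-decreasing. *)

Section null_sets.
Local Open Scope ereal_scope.
Context d (T : measurableType d) (R : realType) (mu : {measure set T -> \bar R}).
Variables (N : set T) (mN : measurable N) (muN0 : mu N = 0).

Import HBNNSimple.

(* A simple function below [f] can be replaced by its product with the
   indicator of [~` N], so the supremum defining the integral of [f] does not
   see [N], even when [f] is not measurable. *)
Let ge0_integral_setC_null (f : T -> \bar R) : (forall x, 0 <= f x) ->
  \int[mu]_x f x = \int[mu]_x (f \_ (~` N)) x.
Proof.
move=> f0.
have fN0 x : 0 <= (f \_ (~` N)) x by exact: erestrict_ge0.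
rewrite !ge0_integralTE//; apply/eqP; rewrite eq_le; apply/andP; split.
  apply: ge_ereal_sup => _ [h /= hf <-].
  have [k kE] : exists k : {nnsfun T >-> R},
      forall x, k x = (h x * (x \in ~` N)%:R)%R.
    by exists (proj_nnsfun h (measurableC mN)) => x /=; rewrite mindicE.
  apply: ereal_sup_ubound; exists k => /=.
    move=> x; rewrite kE patchE; case: ifPn => xN; first by rewrite mulr1.
    by rewrite mulr0.
  rewrite -!integralT_nnsfun; apply: ge0_ae_eq_integral => //.
  - exact/measurable_EFinP/measurable_funP.
  - exact/measurable_EFinP/measurable_funP.
  - by move=> x _; rewrite lee_fin.
  - by move=> x _; rewrite lee_fin.
  - exists N; split => // x /= hx; apply: contrapT => Nx; apply: hx => _.
    by rewrite kE mem_set// mulr1.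
apply: ge_ereal_sup => _ [h /= hf <-].
apply: ereal_sup_ubound; exists h => //= x; apply: le_trans (hf x) _.
by rewrite patchE; case: ifP.
Qed.

(** This discards the null set where [m x] may fail to be a probability measure and
    [Psi (fine (m x C))] is uncontrolled. Once [f] is extended by zero outside [D], its positive and
    negative parts each have an integral that ignores [N]. *)
Lemma integral_setD_null (D : set T) (f : T -> \bar R) :
  \int[mu]_(x in D) f x = \int[mu]_(x in D `\` N) f x.
Proof.
rewrite integralE [RHS]integralE; congr (_ - _);
  rewrite setDE setIC integral_mkcond ge0_integral_setC_null;
  do ?[by move=> x; exact: erestrict_ge0];
  by rewrite -integral_mkcondr setTI -integral_mkcondr.
Qed.

End null_sets.
Arguments integral_setD_null {d T R mu N}.

Lemma ae_integral0 d (T : measurableType d) (R : realType)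
    (mu : {measure set T -> \bar R}) (D : set T) (f : T -> \bar R) :
  {ae mu, forall x, D x -> f x = 0%E} -> (\int[mu]_(x in D) f x = 0)%E.
Proof.
move=> [N [mN muN0 fN]]; rewrite (integral_setD_null mN muN0).
by apply: integral0_eq => x [Dx Nx]; apply: contrapT => fx; apply/Nx/fN => /(_ Dx).
Qed.

(** Since [a + b = s + i], both [a] and [b] are convex combinations of [s] and [i], with the two
    weights exchanged; the two concavity inequalities add up to the claim. *)
Lemma concave_submodular (R : realType) (Psi : R -> R) (i a b s : R) :
  concave_function (`[0, 1]%classic : set R) Psi ->
  0 <= i -> i <= a <= s -> i <= b <= s -> s <= 1 -> s + i = a + b ->
  Psi s + Psi i <= Psi a + Psi b.
Proof.
move=> cPsi i0 /andP[ia as_] /andP[ib bs] s1 siab.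
(* In the degenerate case all four points coincide, and the weights used below would divide by
   zero. *)
have [si|si] := eqVneq s i.
  have -> : a = i by lra.
  have -> : b = i by lra.
  by rewrite si.
have si0 : 0 < s - i by rewrite subr_gt0 lt_neqAle eq_sym si (le_trans ia).
have in01 (x : R) : 0 <= x -> x <= 1 -> x \in (`[0, 1]%classic : set R).
  by move=> x0 x1; rewrite inE/= in_itv/= x0 x1.
have t01 (x : R) : i <= x <= s -> 0 <= (x - i) / (s - i) <= 1.
  move=> /andP[ix xs]; rewrite divr_ge0 ?(ltW si0) ?subr_ge0//=.
  by rewrite ler_pdivrMr// mul1r lerB.
have combE (x : R) : i <= x <= s ->
    (x - i) / (s - i) * Psi s + (1 - (x - i) / (s - i)) * Psi i <= Psi x.
  move=> ixs; have /andP[t0 t1] := t01 x ixs.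
  rewrite -[in leRHS](_ : (x - i) / (s - i) * s + (1 - (x - i) / (s - i)) * i = x).
    by apply: (cPsi (Itv01 t0 t1) s i); apply: in01; lra.
  by field; lra.
have := combE a; have := combE b.
rewrite ia as_ ib bs => /(_ isT) Hb /(_ isT) Ha.
have tab : (b - i) / (s - i) = 1 - (a - i) / (s - i).
  by rewrite (_ : b = s + i - a); [field; lra|lra].
move: Hb; rewrite tab; lra.
Qed.

(* [Psi] is only assumed monotone on [0, 1]; precomposing it with the
   projection onto [0, 1] yields a monotone, hence measurable, function. *)
Lemma measurable_fun_homo01 d (T : measurableType d) (R : realType)
    (D : set T) (f : T -> R) (Psi : R -> R) :
  measurable D -> measurable_fun D f -> (forall x, D x -> 0 <= f x <= 1) ->
  {in `[0, 1] &, {homo Psi : x y / x <= y}} ->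
  measurable_fun D (Psi \o f).
Proof.
move=> mD mf f01 Psi_homo.
pose clamp (t : R) := Num.min (Num.max t 0) 1.
have clamp01 t : clamp t \in `[0, 1].
  by rewrite in_itv/= /clamp le_min le_max lexx orbT ler01 ge_min lexx orbT.
apply: (@eq_measurable_fun _ _ _ _ _ ((Psi \o clamp) \o f)).
  move=> x /set_mem /f01 /andP[f0 f1] /=.
  by rewrite /clamp (max_idPl f0) (min_idPl f1).
apply: measurableT_comp mf; apply: nondecreasing_measurable => // x y xy /=.
apply: Psi_homo; rewrite ?clamp01//.
by apply: le_min2 => //; exact: le_max2.
Qed.

Lemma probability_fine01 d (T : measurableType d) (R : realType)
    (P : probability T R) (A : set T) : measurable A -> 0 <= fine (P A) <= 1.
Proof.
by move=> mA; rewrite fine_ge0//= -lee_fin fineK ?fin_num_measure// probability_le1.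
Qed.

Lemma probability_fineUI d (T : measurableType d) (R : realType)
    (P : probability T R) (A B : set T) : measurable A -> measurable B ->
  fine (P (A `|` B)) + fine (P (A `&` B)) = fine (P A) + fine (P B).
Proof.
move=> mA mB; have mI := measurableI _ _ mA mB.
have fP C : measurable C -> P C \is a fin_num by exact: fin_num_measure.
rewrite measureUfinr//; last by rewrite ltey_eq fP.
by rewrite fineB ?fineD ?fin_numD ?fP// subrK.
Qed.

Lemma fine_probability_le d (T : measurableType d) (R : realType)
    (P : probability T R) (A B : set T) : measurable A -> measurable B ->
  A `<=` B -> fine (P A) <= fine (P B).
Proof.
move=> mA mB AB; apply: fine_le; rewrite ?fin_num_measure//.
by apply: le_measure; rewrite ?inE.
Qed.

(** The value 0 on [C] gives different sets [C] a common domain of integration, so that their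
    integrands can be compared pointwise. *)
Definition half_perimeter_integrand {X : Type} {R : realType}
    (p : set X -> \bar R) (Psi : R -> R) (x : X) (C : set X) : R :=
  if x \in C then 0 else Psi (fine (p C)).

Lemma half_perimeter_integrand_submodular d (X : measurableType d)
    (R : realType) (P : probability X R) (Psi : R -> R) (A B : set X) (x : X) :
  concave_function (`[0, 1]%classic : set R) Psi ->
  {in `[0, 1] &, {homo Psi : x y / x <= y}} ->
  measurable A -> measurable B ->
  half_perimeter_integrand P Psi x (A `|` B) +
    half_perimeter_integrand P Psi x (A `&` B) <=
  half_perimeter_integrand P Psi x A + half_perimeter_integrand P Psi x B.
Proof.
move=> cPsi hPsi mA mB; rewrite /half_perimeter_integrand in_setU in_setI.
have mU := measurableU _ _ mA mB; have mI := measurableI _ _ mA mB.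
have p01 C : measurable C -> fine (P C) \in `[0, 1].
  by move=> mC; rewrite in_itv/= probability_fine01.
case: (x \in A); case: (x \in B) => //=.
(* When [x] lies in exactly one of the two sets, the intersection alone contributes on the left and
   the other set alone on the right, so monotonicity suffices. *)
- by rewrite lerD2l hPsi ?p01// fine_probability_le.
- by rewrite addrC lerD2r hPsi ?p01// fine_probability_le.
have /andP[I0 _] := probability_fine01 _ _ _ P _ mI.
have /andP[_ U1] := probability_fine01 _ _ _ P _ mU.
apply: concave_submodular => //; rewrite ?fine_probability_le//.
exact: probability_fineUI.
Qed.

Definition half_perimeter {d} {X : measurableType d} {R : realType}
    (nu : set X -> \bar R) (m : X -> set X -> \bar R)
    (Psi : R -> R) (C : set X) : \bar R :=
  (\int[nu]_(x in ~` C) (Psi (fine (m x C)))%:E)%E.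

Lemma ProbPerE d (X : measurableType d) (R : realType)
    (mu : probability (X * bool)%type R) (m : X -> set X -> \bar R)
    (Psi : R -> R) (C : set X) :
  ProbPer mu m Psi C = (half_perimeter (rho mu false) m Psi C +
                        half_perimeter (rho mu true) m Psi (~` C))%E.
Proof. by rewrite /half_perimeter setCK. Qed.

Lemma half_perimeter_submodular d (X : measurableType d) (R : realType)
    (nu : {measure set X -> \bar R}) (m : X -> set X -> \bar R) (Psi : R -> R)
    (A B : set X) :
  {ae nu, forall x, is_probability (m x)} ->
  (forall C, measurable C -> measurable_fun [set: X] (m ^~ C)) ->
  set_fun `[0, 1]%classic `[0, 1]%classic Psi ->
  concave_function (`[0, 1]%classic : set R) Psi ->
  {in `[0, 1] &, {homo Psi : x y / x <= y}} ->
  measurable A -> measurable B ->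
  (half_perimeter nu m Psi (A `|` B) + half_perimeter nu m Psi (A `&` B) <=
   half_perimeter nu m Psi A + half_perimeter nu m Psi B)%E.
Proof.
move=> [N [mN nuN0 mP]] mm Psi01 cPsi hPsi mA mB.
have mU := measurableU _ _ mA mB; have mI := measurableI _ _ mA mB.
have mG : measurable (~` N) by exact: measurableC.
have Pm x : (~` N) x -> exists P : probability X R,
    forall C, measurable C -> m x C = P C.
  by move=> Nx; apply: contrapT => nP; apply/Nx/mP.
pose g C x := half_perimeter_integrand (m x) Psi x C.
have gE C : g C = (fun x => Psi (fine (m x C))) \_ (~` C).
  apply/funext => x; rewrite patchE in_setC /g /half_perimeter_integrand.
  by case: (x \in C).
(* All four half perimeters become integrals over the complement of [N], where [m x] agrees with a
   probability measure. *)
have hpE C : half_perimeter nu m Psi C = (\int[nu]_(x in ~` N) (g C x)%:E)%E.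
  rewrite /half_perimeter (integral_setD_null mN nuN0) setDE integral_mkcondl.
  by apply: eq_integral => x _; rewrite gE !patchE; case: ifP.
have m01 C x : measurable C -> (~` N) x -> 0 <= fine (m x C) <= 1.
  by move=> mC /Pm[P ->//]; exact: probability_fine01.
(* Nonnegativity comes from the range of [Psi]; with measurability it makes the integral additive
   without an integrability argument. *)
have g0 C x : measurable C -> (~` N) x -> (0 <= (g C x)%:E)%E.
  move=> mC Nx; rewrite lee_fin gE patchE; case: ifP => // _.
  have /Psi01 : `[0, 1]%classic (fine (m x C)) by rewrite /= in_itv/= m01.
  by rewrite /= in_itv => /andP[].
have mg C : measurable C -> measurable_fun (~` N) (fun x => (g C x)%:E).
  move=> mC; apply/measurable_EFinP; rewrite gE.
  apply/(measurable_restrict _ (measurableC mC) mG).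
  have mGC := measurableI _ _ mG (measurableC mC).
  apply: (measurable_fun_homo01 _ _ _ _ (fun x => fine (m x C))) => //.
    apply: measurableT_comp; first exact: fine_measurable.
    by apply: measurable_funTS; exact: mm.
  by move=> x [Nx _]; exact: m01.
rewrite !hpE -!ge0_integralD//; do ?[by move=> x; exact: g0 | exact: mg].
apply: ge0_le_integral => //.
- by move=> x Nx; rewrite adde_ge0// g0.
- by apply: emeasurable_funD; exact: mg.
- by apply: emeasurable_funD; exact: mg.
(* [P] depends on [x], and its agreement with [m x] is granted on measurable sets only. *)
move=> x /Pm[P PE].
have gP C : measurable C -> g C x = half_perimeter_integrand P Psi x C.
  by move=> mC; rewrite /g /half_perimeter_integrand PE.
rewrite -!EFinD lee_fin !gP//.
exact: half_perimeter_integrand_submodular.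
Qed.

Theorem proposition6 (R : realType) (d : measure_display) (X : measurableType d)
  (mu : probability (X * bool)%type R)
  (m : X -> set X -> \bar R)
  (m_prob : {ae measure_add (rho mu false) (rho mu true),
               forall x, is_probability (m x)})
  (m_meas : forall B : set X, measurable B ->
               measurable_fun [set: X] (m ^~ B))
  (Psi : R -> R)
  (Psi01 : set_fun `[0, 1]%classic `[0, 1]%classic Psi) :
  (Psi 0 = 0 ->
     ProbPer mu m Psi [set: X] = 0%E /\ ProbPer mu m Psi set0 = 0%E) /\
  (concave_function (`[0, 1]%classic : set R) Psi ->
   {in `[0, 1] &, {homo Psi : x y / x <= y}} ->
     forall A B : set X, measurable A -> measurable B ->
       (ProbPer mu m Psi (A `|` B) + ProbPer mu m Psi (A `&` B)
          <= ProbPer mu m Psi A + ProbPer mu m Psi B)%E).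
Proof.
(* Measures being nonnegative, a null set of the sum is null for both summands. *)
have m_prob_rho i : {ae rho mu i, forall x, is_probability (m x)}.
  case: m_prob => N [mN rhoN0 mP]; exists N; split => //.
  move: rhoN0; rewrite measure_addE => /eqP.
  by rewrite padde_eq0// => /andP[/eqP r0 /eqP r1]; case: i.
split.
  (* For the full set and for the empty set alike, one integral has empty domain and the other
     involves only [m x set0]. *)
  move=> Psi0; have int0 i D :
      (\int[rho mu i]_(x in D) (Psi (fine (m x set0)))%:E = 0)%E.
    apply: ae_integral0; apply: filterS (m_prob_rho i) => x [P PE] _.
    by rewrite PE// measure0 /= Psi0.
  by rewrite /ProbPer setCT setC0 !integral_set0 !int0 adde0.
move=> cPsi hPsi A B mA mB; rewrite !ProbPerE setCU setCI addeACA [leRHS]addeACA.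
have hpU i C D : measurable C -> measurable D -> _ :=
  half_perimeter_submodular _ _ _ _ _ _ C D (m_prob_rho i) m_meas Psi01 cPsi hPsi.
(* For the label 1, De Morgan has put the intersection of the complements before their union, hence
   the swap. *)
by apply: leeD; [|rewrite addeC]; apply: hpU => //; exact: measurableC.
Qed.
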